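(* Let $\Sigma$ be a finite signature. $\alpha$-equivalence of bar $\Sigma$-trees is decidable in polynomial time: there is a polynomial-time algorithm that, given two bar $\Sigma$-trees $s,t$, decides whether $s\equiv_\alpha t$.
   Context: $\mathbb A$ is a fixed countably infinite set of names; $\overline{\mathbb A}=\mathbb A\cup\{\vert a : a\in\mathbb A\}$, where $a$ is a plain name and $\vert a$ a bar name. A signature $\Sigma$ is a set of symbols with finite arities. A bar $\Sigma$-tree is a finite ordered tree (closed term) over the signature containing one $n$-ary symbol $\alpha.f$ for every $\alpha\in\overline{\mathbb A}$ and every $n$-ary $f\in\Sigma$. Finite permutations $\pi$ of $\mathbb A$ act by $\pi\cdot a=\pi(a)$, $\pi\cdot\vert a=\vert\pi(a)$ and $\pi\cdot(\alpha.f(t_1,\dots,t_n))=(\pi\cdot\alpha).f(\pi\cdot t_1,\dots,\pi\cdot t_n)$; $(a\ c)$ is the transposition of $a$ and $c$. For bar trees $t,t'$ write $\langle a\rangle t=\langle b\rangle t'$ iff $(a\ c)\cdot t=(b\ c)\cdot t'$ for some (equivalently every) name $c\notin\{a,b\}$ not occurring (plain or barred) in $t$ or $t'$. $\alpha$-equivalence $\equiv_\alpha$ is the least congruence on bar $\Sigma$-trees such that $\vert a.f(t_1,\dots,t_n)\equiv_\alpha\vert b.f(t_1',\dots,t_n')$ whenever $\langle a\rangle t_i=\langle b\rangle t_i'$ for all $1\le i\le n$. *)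

(* Defs.v *)
From HB Require Import structures.
From mathcomp Require Import all_boot all_algebra.
Set Implicit Arguments.
Unset Strict Implicit.
Unset Printing Implicit Defensive.

Inductive move := MoveL | MoveS | MoveR.

(* Deterministic multitape Turing machine with input alphabet [I].  Tape cells
   hold [None] (blank), [Some (inl x)] (input symbol) or [Some (inr y)]
   (auxiliary symbol).  [delta] is a finite object, since its domain is finite;
   it is not used in states [q] with [halt q <> None], where [halt q = Some b]
   means: stop with answer [b]. *)
Record machine (I : finType) := Machine {
  state : finType;
  aux : finType;
  ntapes : nat; (* in addition to the input tape, which is tape [ord0] *)
  start : state;
  halt : state -> option bool;
  delta : state -> {ffun 'I_ntapes.+1 -> option (I + aux)} ->
          state * ('I_ntapes.+1 -> option (I + aux) * move)
}.

Section Tapes.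
Variable X : Type.

(* A two-way infinite tape of cells [option X]: the cells to the left of the
   head, nearest first, the scanned cell, and the cells to the right of the
   head; all cells that are not listed are blank. *)
Record tape := Tape {
  cells_left : seq (option X); scanned : option X; cells_right : seq (option X) }.

Definition blank_tape := Tape [::] None [::].

Definition input_tape (w : seq X) : tape :=
  if w is x :: w' then Tape [::] (Some x) (map Some w') else blank_tape.

Definition write (x : option X) (t : tape) := Tape (cells_left t) x (cells_right t).

Definition shift (m : move) (t : tape) : tape :=
  let: Tape l x r := t in
  match m with
  | MoveS => t
  | MoveL => if l is y :: l' then Tape l' y (x :: r) else Tape [::] None (x :: r)
  | MoveR => if r is y :: r' then Tape (x :: l) y r' else Tape (x :: l) None [::]
  end.

End Tapes.

Section Runs.
Variables (I : finType) (M : machine I).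

Record config := Config {
  cstate : state M;
  ctapes : 'I_(ntapes M).+1 -> tape (I + aux M) }.

Definition init (w : seq I) : config :=
  Config (start M)
    (fun k => if k == ord0 then input_tape (map inl w) else blank_tape _).

Definition step (c : config) : config :=
  if halt (cstate c) is Some _ then c else
  let: (q, instr) := delta (cstate c) [ffun k => scanned (ctapes c k)] in
  Config q (fun k => shift (instr k).2 (write (instr k).1 (ctapes c k))).

Definition halts_within (n : nat) (w : seq I) (b : bool) : Prop :=
  exists2 m, m <= n & halt (cstate (iter m step (init w))) = Some b.

End Runs.

(* Decision problem with instances [x : T], presented to the machine as the
   words [enc x]; time is measured in the length of these words. *)
Definition ptime_decidable (T : Type) (I : finType) (enc : T -> seq I)
    (P : T -> Prop) : Prop :=
  exists (M : machine I) (p : {poly nat}), forall x : T,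
    exists2 b : bool,
      halts_within M (p.[size (enc x)])%R (enc x) b & (b <-> P x).

(* Any countably infinite set would do; see [bits] for how names are written. *)
Definition name := nat.

Inductive bname := Plain of name | Bar of name.

Definition name_of (alpha : bname) : name :=
  match alpha with Plain a => a | Bar a => a end.

Definition act_bname (pi : name -> name) (alpha : bname) : bname :=
  match alpha with Plain a => Plain (pi a) | Bar a => Bar (pi a) end.

Definition transposition (a c : name) : name -> name :=
  [fun x => x with a |-> c, c |-> a].

Section BarTrees.
Variables (S : finType) (ar : S -> nat).

Inductive tree : Type :=
  Node (alpha : bname) (f : S) (ts : {ffun 'I_(ar f) -> tree}).

Fixpoint act (pi : name -> name) (t : tree) : tree :=
  let: Node alpha f ts := t in
  Node (act_bname pi alpha) [ffun i => act pi (ts i)].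

Fixpoint names (t : tree) : seq name :=
  let: Node alpha f ts := t in
  name_of alpha :: flatten [seq names (ts i) | i <- enum 'I_(ar f)].

(* <a>t = <b>t' *)
Definition abs_eq (a : name) (t : tree) (b : name) (t' : tree) : Prop :=
  exists c : name,
    [/\ c \notin [:: a; b], c \notin names t, c \notin names t'
      & act (transposition a c) t = act (transposition b c) t'].

Inductive alpha_eq : tree -> tree -> Prop :=
| alpha_refl t : alpha_eq t t
| alpha_sym t u : alpha_eq t u -> alpha_eq u t
| alpha_trans t u v : alpha_eq t u -> alpha_eq u v -> alpha_eq t v
| alpha_cong alpha f (ts us : {ffun 'I_(ar f) -> tree}) :
    (forall i, alpha_eq (ts i) (us i)) ->
    alpha_eq (Node alpha ts) (Node alpha us)
| alpha_bar a b f (ts us : {ffun 'I_(ar f) -> tree}) :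
    (forall i, abs_eq a (ts i) b (us i)) ->
    alpha_eq (Node (Bar a) ts) (Node (Bar b) us).

End BarTrees.

Inductive token (S : Type) :=
  TBit of bool | TBar | TSym of S | TOpen | TClose | TSep.
Arguments TBit {S}.
Arguments TBar {S}.
Arguments TOpen {S}.
Arguments TClose {S}.
Arguments TSep {S}.

Definition token_code S (x : token S) : bool + S + 'I_4 :=
  match x with
  | TBit b => inl (inl b) | TSym f => inl (inr f)
  | TBar => inr (inord 0) | TOpen => inr (inord 1)
  | TClose => inr (inord 2) | TSep => inr (inord 3)
  end.

Definition token_decode S (x : bool + S + 'I_4) : token S :=
  match x with
  | inl (inl b) => TBit b | inl (inr f) => TSym f
  | inr k => nth TSep [:: TBar; TOpen; TClose] k
  end.

Lemma token_codeK S : cancel (@token_code S) (@token_decode S).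
Proof. by case=> //=; rewrite inordK. Qed.

HB.instance Definition _ (S : finType) :=
  Finite.copy (token S) (can_type (@token_codeK S)).

Fixpoint pos_bits (p : BinNums.positive) : bitseq :=
  match p with
  | BinNums.xH => [:: true]
  | BinNums.xO p => false :: pos_bits p
  | BinNums.xI p => true :: pos_bits p
  end.

(* Binary numerals, least significant bit first; 0 is the empty word. *)
Definition bits (n : nat) : bitseq :=
  if bin_of_nat n is BinNums.Npos p then pos_bits p else [::].

Section Encoding.
Variables (S : finType) (ar : S -> nat).

Definition encode_bname (alpha : bname) : seq (token S) :=
  match alpha with
  | Plain a => map TBit (bits a)
  | Bar a => TBar :: map TBit (bits a)
  end.

Fixpoint encode (t : tree ar) : seq (token S) :=
  let: Node alpha f ts := t in
  encode_bname alpha ++ TSym f :: TOpen ::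
    flatten [seq encode (ts i) | i <- enum 'I_(ar f)] ++ [:: TClose].

Definition encode_pair (st : tree ar * tree ar) : seq (token S) :=
  encode st.1 ++ TSep :: encode st.2.

End Encoding.

Lemma bits_inj : injective bits.
Proof.
have pinj : injective pos_bits.
  elim=> [p IH|p IH|] [q|q|] //=.
  - by case=> /IH->.
  - by case; case: p {IH}.
  - by case=> /IH->.
  - by case; case: q.
move=> m n E; apply: (can_inj bin_of_natK); move: E; rewrite /bits.
case: (bin_of_nat m) (bin_of_nat n) => [|p] [|q] //.
- by case: q.
- by case: p.
- by move/pinj->.
Qed.

Section EncodingInj.
Variables (S : finType) (ar : S -> nat).

Lemma tree_ind_ffun (P : tree ar -> Prop) :
  (forall alpha f (ts : {ffun 'I_(ar f) -> tree ar}),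
     (forall i, P (ts i)) -> P (Node alpha ts)) ->
  forall t, P t.
Proof.
by move=> IH; fix rec 1 => -[alpha f ts]; apply: IH => i; apply: rec.
Qed.

Lemma encode_prefix (s t : tree ar) u v :
  encode s ++ u = encode t ++ v -> s = t /\ u = v.
Proof.
have bpre (x y : bitseq) f g (u' v' : seq (token S)) :
    map TBit x ++ TSym f :: u' = map TBit y ++ TSym g :: v' ->
    [/\ x = y, f = g & u' = v'].
  elim: x y => [|b x IH] [|c y] //=; first by case=> -> ->.
  by case=> -> /IH[-> -> ->].
elim/tree_ind_ffun: s t u v => alpha f ts IH [beta g us] u v /=.
rewrite -!catA /=.
have bnpre f' g' (u' v' : seq (token S)) :
    encode_bname S alpha ++ TSym f' :: u' = encode_bname S beta ++ TSym g' :: v' ->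
    [/\ alpha = beta, f' = g' & u' = v'].
  case: alpha beta => [a|a] [b|b] /=.
  - by move/bpre=> [/bits_inj-> -> ->].
  - by case: (bits a).
  - by case: (bits b).
  - by case=> /bpre[/bits_inj-> -> ->].
case/bnpre=> <- eg; case: g / eg us => us [].
rewrite -!catA /= => E.
have {E} [E1 E2] : (forall i, i \in enum 'I_(ar f) -> ts i = us i) /\ u = v.
  elim: (enum _) E => [|i r IHr] /=; first by case=> ->.
  rewrite -!catA => /IH[Ei /IHr[Er ->]]; split=> // j.
  by rewrite inE => /predU1P[->|/Er].
split=> //; congr Node; apply/ffunP => i; apply: E1; exact: mem_enum.
Qed.

Lemma encode_pair_inj : injective (@encode_pair S ar).
Proof.
by case=> s t [s' t'] /encode_prefix[/= -> [/(congr1 (cat^~ [::]))/encode_prefix[-> _]]].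
Qed.

End EncodingInj.

(* Main.v *)
(* Replacing every plain name by the position of its nearest enclosing bar name
   turns a bar tree into a de Bruijn code, and two trees are alpha-equivalent
   iff their codes coincide: codes are invariant under alpha-equivalence, and
   conversely, once both head binders are renamed to a common fresh name, trees
   with equal codes are alpha-equivalent by induction.  The code is computed by
   one pass over the input with a stack holding the heads of the open nodes;
   resolving a plain name takes at most quadratic time in one traversal of the
   stack, so the whole run takes cubic time. *)

From HB Require Import structures.
Require Import Defs.
From mathcomp Require Import all_boot all_algebra zify.
Set Implicit Arguments.
Unset Strict Implicit.
Unset Printing Implicit Defensive.

(** * A canonical form for alpha-equivalence *)

Section AlphaCode.
Variables (S : finType) (ar : S -> nat).
Implicit Types (t u : tree ar) (E : seq (option name)) (a : name).

(* One [TClose] per ancestor that is skipped, then [TOpen] if a binder of [a] is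
   found; a free name is written in full after [TSep].  The bits are reversed
   because the machine copies them while moving left. *)
Fixpoint name_code E a : seq (token S) :=
  match E with
  | [::] => TSep :: rev (map TBit (bits a))
  | e :: E' => if e == Some a then [:: TOpen] else TClose :: name_code E' a
  end.

Definition bname_code E (alpha : bname) : seq (token S) :=
  if alpha is Plain a then name_code E a else [:: TBar].

Definition frame (alpha : bname) : option name :=
  if alpha is Bar a then Some a else None.

(** No closing bracket is emitted, since the arity of [f] fixes the number of children. Plain heads
    also push a frame, so positions count all ancestors. *)
Fixpoint alpha_code E t : seq (token S) :=
  let: Node alpha f ts := t in
  bname_code E alpha ++
    TSym f :: flatten [seq alpha_code (frame alpha :: E) (ts i) | i <- enum 'I_(ar f)].

(** Both names are resolved in the same [E], so stopping at the same frame forces equality; for free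
    names the symbol delimits the bits. *)
Lemma name_code_prefix E a b f g (v w : seq (token S)) :
  name_code E a ++ TSym f :: v = name_code E b ++ TSym g :: w ->
  [/\ a = b, f = g & v = w].
Proof.
elim: E => [|e E IH] /=.
  case; have rbits x : rev (map TBit (bits x)) = map (@TBit S) (rev (bits x)).
    by rewrite map_rev.
  rewrite !rbits => H.
  suff [/(can_inj revK)/bits_inj-> -> ->] :
    [/\ rev (bits a) = rev (bits b), f = g & v = w] by [].
  elim: (rev _) (rev _) H => [|x r IHr] [|y r'] //=; first by case=> -> ->.
  by case=> -> /IHr[-> -> ->].
case: eqP => [->|_]; case: eqP => [|_] //=.
- by case=> -> [-> ->].
- by case=> /IH.
Qed.

Lemma bname_code_prefix E (alpha beta : bname) f g (v w : seq (token S)) :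
  bname_code E alpha ++ TSym f :: v = bname_code E beta ++ TSym g :: w ->
  [/\ f = g, v = w & (alpha = beta) \/ (exists a b, alpha = Bar a /\ beta = Bar b)].
Proof.
have tbarP a x y : name_code E a ++ x <> TBar :: y.
  by case: E => [|e E] //=; case: eqP.
case: alpha beta => [a|a] [b|b] /=.
- by case/name_code_prefix=> -> -> ->; split=> //; left.
- by move/tbarP.
- by move/esym/tbarP.
- by case=> -> ->; split=> //; right; exists a, b.
Qed.

(** * Renaming of trees and invariance of codes *)

Lemma actE (pi : name -> name) alpha f (ts : {ffun 'I_(ar f) -> tree ar}) :
  act pi (Node alpha ts) = Node (act_bname pi alpha) [ffun i => act pi (ts i)].
Proof. by []. Qed.

Lemma Node_eq alpha beta f (ts us : {ffun 'I_(ar f) -> tree ar}) :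
  alpha = beta -> ts =1 us -> Node alpha ts = Node beta us.
Proof. by move=> -> /ffunP->. Qed.

Lemma act_comp (pi rho : name -> name) t :
  act pi (act rho t) = act (pi \o rho) t.
Proof.
elim/tree_ind_ffun: t => alpha f ts IH ; rewrite ?actE; apply: Node_eq; first by case: alpha.
by move=> i; rewrite !ffunE IH.
Qed.

Lemma act_id t : act id t = t.
Proof.
elim/tree_ind_ffun: t => alpha f ts IH ; rewrite ?actE; apply: Node_eq; first by case: alpha.
by move=> i; rewrite !ffunE IH.
Qed.

Lemma names_child x alpha f (ts : {ffun 'I_(ar f) -> tree ar}) i :
  x \in names (ts i) -> x \in names (Node alpha ts).
Proof.
move=> xi /=; rewrite inE; apply/orP; right; apply/flattenP.
by exists (names (ts i)) => //; apply/mapP; exists i; rewrite ?mem_enum.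
Qed.

Lemma eq_in_act (pi rho : name -> name) t :
  {in names t, pi =1 rho} -> act pi t = act rho t.
Proof.
elim/tree_ind_ffun: t => alpha f ts IH H; rewrite !actE; apply: Node_eq.
  have /H : name_of alpha \in names (Node alpha ts) by rewrite /= mem_head.
  by case: alpha {IH H} => a /= ->.
by move=> i; rewrite !ffunE; apply: IH => x /names_child/H.
Qed.

(** Below a new binder the hypothesis persists because an injective [pi] preserves and reflects
    equality with the bound name. *)
Lemma alpha_code_act (pi : name -> name) E E' t :
  injective pi ->
  {in names t, forall x, name_code E x = name_code E' (pi x)} ->
  alpha_code E t = alpha_code E' (act pi t).
Proof.
move=> pi_inj; elim/tree_ind_ffun: t E E' => alpha f ts IH E E' H; rewrite actE /=.
have codeE : bname_code E alpha = bname_code E' (act_bname pi alpha).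
  have /H : name_of alpha \in names (Node alpha ts) by rewrite /= mem_head.
  by case: alpha {IH H}.
rewrite codeE; congr (_ ++ _ :: flatten _); apply: eq_map => i; rewrite ffunE.
apply: IH => x /names_child/H; case: alpha {codeE H} => y /= ->; last first.
  by rewrite !(inj_eq Some_inj) (inj_eq pi_inj).
by [].
Qed.

Lemma transposition_inj a c : injective (transposition a c).
Proof.
suff K : involutive (transposition a c) by apply: inv_inj.
move=> x; rewrite /transposition /=.
case: (eqVneq x a) => [->|xa].
  by rewrite eqxx; case: (eqVneq c a).
by case: (eqVneq x c) => [->|xc]; rewrite ?eqxx // (negPf xa) (negPf xc).
Qed.

Lemma alpha_code_rename E a c t : c \notin names t ->
  alpha_code (Some a :: E) t = alpha_code (Some c :: E) (act (transposition a c) t).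
Proof.
move=> ct; apply: alpha_code_act; first exact: transposition_inj.
move=> x xt; rewrite /transposition /= !(inj_eq Some_inj).
have xc : x != c by apply: contraNneq ct => <-.
case: (eqVneq x a) => [_|xa]; first by rewrite ?eqxx.
by rewrite (negPf xc) (eq_sym c) (negPf xc).
Qed.

(** The environment is quantified inside, as [alpha_cong] extends it. For [alpha_bar], both sides
    are renamed to the common witness [c]. *)
Lemma alpha_code_eq t u : alpha_eq t u -> forall E, alpha_code E t = alpha_code E u.
Proof.
elim=> {t u} //= [t u v _ IHtu _ IHuv E|alpha f ts us _ IH E|a b f ts us H E].
- by rewrite IHtu.
- by congr (_ ++ _ :: flatten _); apply: eq_map => i; apply: IH.
congr (_ :: _ :: flatten _); apply: eq_map => i.
have [c [_ ct cu tu]] := H i.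
by rewrite (alpha_code_rename _ _ ct) tu -alpha_code_rename.
Qed.

(** * Equal codes imply alpha-equivalence *)

Lemma fresh (s : seq name) : {c : name | c \notin s}.
Proof.
(* One plus the sum of the list exceeds each of its elements. *)
exists (foldr addn 1 s); apply/negP => H.
suff : forall x, x \in s -> x < foldr addn 1 s by move/(_ _ H); rewrite ltnn.
elim: s {H} => //= y s IH x; rewrite inE => /predU1P[->|/IH]; last by lia.
suff : 0 < foldr addn 1 s by lia.
by elim: s {IH} => //= z s; lia.
Qed.

(** With a second fresh name [d], swapping [a] and [c] and then [c] and [d] agrees with swapping [a]
    and [d] on all names other than [c] and [d]. *)
Lemma alpha_rename a c f (ts : {ffun 'I_(ar f) -> tree ar}) :
  (forall i, c \notin names (ts i)) ->
  alpha_eq (Node (Bar a) ts)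
           (Node (Bar c) [ffun i => act (transposition a c) (ts i)]).
Proof.
move=> cts; apply: alpha_bar => i; rewrite ffunE.
have [d] := fresh (a :: c :: names (ts i) ++ names (act (transposition a c) (ts i))).
rewrite !inE mem_cat !negb_or => /and4P[da dc dt dt'].
exists d; split=> //; first by rewrite !inE !negb_or da.
rewrite act_comp; apply: eq_in_act => x xt; rewrite /transposition /=.
have xc : x != c by apply: contraNneq (cts i) => <-.
have xd : x != d by apply: contraNneq dt => <-.
by case: (eqVneq x a) => [|xa]; rewrite ?eqxx // (negPf xc) (negPf xd) (negPf xc).
Qed.

Lemma flatten_prefix (I : eqType) (X : Type) (F G : I -> seq X) (P : I -> Prop) r v w :
  (forall i v w, F i ++ v = G i ++ w -> P i /\ v = w) ->
  flatten (map F r) ++ v = flatten (map G r) ++ w ->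
  {in r, forall i, P i} /\ v = w.
Proof.
move=> FG; elim: r => [|i r IH] //=; rewrite -!catA => /FG[Pi /IH[Pr ->]].
by split=> // j; rewrite inE => /predU1P[->|/Pr].
Qed.

(** The suffixes [v] and [w] let the induction parse the concatenated codes of the children. Under
    bar heads, both families of children are renamed to one fresh name. *)
Lemma alpha_code_prefix t u E (v w : seq (token S)) :
  alpha_code E t ++ v = alpha_code E u ++ w -> alpha_eq t u /\ v = w.
Proof.
(* Renaming apart turns subtrees into permuted subtrees, hence the [act pi]. *)
suff H : forall pi u E v w,
    alpha_code E (act pi t) ++ v = alpha_code E u ++ w ->
    alpha_eq (act pi t) u /\ v = w by move: (H id u E v w); rewrite act_id.
elim/tree_ind_ffun: t => {u E v w} alpha f ts IH pi [beta g us] E v w.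
rewrite actE /= -!catA /= => /bname_code_prefix[fg vw ab]; move: vw.
move: ab => -[|]; last first.
  move=> [a [b [ea eb]]]; rewrite ea eb; case: g / fg us => us /=.
  have [c] := fresh (flatten [seq names (act pi (ts i)) | i <- enum 'I_(ar f)] ++
                     flatten [seq names (us i) | i <- enum 'I_(ar f)]).
  rewrite mem_cat negb_or => /andP[ct cu].
  have cti i : c \notin names ([ffun i => act pi (ts i)] i).
    apply: contra ct; rewrite ffunE => ci; apply/flattenP.
    by eexists; [apply/mapP; exists i; rewrite ?mem_enum|].
  have cui i : c \notin names (us i).
    apply: contra cu => ci; apply/flattenP.
    by eexists; [apply/mapP; exists i; rewrite ?mem_enum|].
  case/(@flatten_prefix _ _ _ _ (fun i => alpha_eq
      (act (transposition a c) ([ffun i => act pi (ts i)] i))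
      (act (transposition b c) (us i)))).
    move=> i v' w'; rewrite (alpha_code_rename _ _ (cti i)).
    (* The induction hypothesis is used for the transposition composed with [pi]. *)
    by rewrite (alpha_code_rename _ _ (cui i)) ffunE act_comp; apply: IH.
  move=> tu ->; split=> //.
  apply: alpha_trans (alpha_rename _ cti) _.
  apply: alpha_trans (alpha_sym (alpha_rename _ cui)).
  by apply: alpha_cong => i; rewrite !ffunE; move: (tu i (mem_enum _ i)); rewrite ffunE.
move=> {}ab; case: g / fg us => us; rewrite ab /=.
case/(@flatten_prefix _ _ _ _ (fun i => alpha_eq ([ffun i => act pi (ts i)] i) (us i))).
  by move=> i v' w'; rewrite ffunE; apply: IH.
by move=> tu ->; split=> //; apply: alpha_cong => i; apply: tu; rewrite mem_enum.
Qed.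

Lemma alpha_codeP t u : alpha_code [::] t = alpha_code [::] u <-> alpha_eq t u.
Proof.
split=> [tu|/alpha_code_eq//].
by case: (@alpha_code_prefix t u [::] [::] [::]); rewrite ?cats0.
Qed.
End AlphaCode.

(** * Tapes up to trailing blanks *)

Section Zippers.
Variables (X Y : Type) (h : X -> Y).

(* Cells to the left of the head, nearest first, and cells from the head on. *)
Definition zipper := (seq (option Y) * seq (option Y))%type.

(* Consing onto a half-tape whose trailing blanks are not represented. *)
Definition bcons (x : option Y) (s : seq (option Y)) :=
  if x is Some _ then x :: s else if s is [::] then [::] else x :: s.

Definition read (z : zipper) := head None z.2.

Definition put x (z : zipper) : zipper := (z.1, bcons x (behead z.2)).

Definition go (m : move) (z : zipper) : zipper :=
  match m with
  | MoveS => z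
  | MoveL => (behead z.1, bcons (head None z.1) z.2)
  | MoveR => (bcons (head None z.2) z.1, behead z.2)
  end.

Lemma head_bcons x s : head None (bcons x s) = x.
Proof. by case: x s => [x|] []. Qed.

Lemma behead_bcons x s : behead (bcons x s) = s.
Proof. by case: x s => [x|] []. Qed.

(** A normal form without trailing blanks: half-tapes with the same contents become equal, so runs
    can be compared by plain equality. *)
Definition strip (s : seq (option X)) := foldr (fun x => bcons (omap h x)) [::] s.

Definition zip_of (t : tape X) : zipper :=
  let: Tape l x r := t in (strip l, strip (x :: r)).

Lemma read_zip t : read (zip_of t) = omap h (scanned t).
Proof. by case: t => l x r; rewrite /read /= head_bcons. Qed.

Lemma zip_write x t : zip_of (write x t) = put (omap h x) (zip_of t).
Proof. by case: t => l y r; rewrite /put /= behead_bcons. Qed.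

Lemma write_scanned (t : tape X) : write (scanned t) t = t.
Proof. by case: t. Qed.

Lemma zip_shift m t : zip_of (shift m t) = go m (zip_of t).
Proof.
case: t => l x r; case: m => //=; rewrite ?head_bcons ?behead_bcons //.
  by case: l => [|y l] //=; rewrite ?head_bcons ?behead_bcons.
by case: r.
Qed.

(* [ZL l r] is [Z l r] with the head one cell further left, which is a blank cell
   when [l] is empty. *)
Definition Z (l r : seq Y) : zipper := (map Some l, map Some r).
Definition ZL (l r : seq Y) : zipper := go MoveL (Z l r).

Lemma goR_ZL l r : go MoveR (ZL l r) = Z l r.
Proof. by rewrite /ZL /= head_bcons behead_bcons; case: l. Qed.

Lemma read_ZL l r : read (ZL l r) = ohead l.
Proof. by rewrite /read /= head_bcons; case: l. Qed.

Lemma read_Z l r : read (Z l r) = ohead r.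
Proof. by case: r. Qed.

End Zippers.

(** * The machine *)

(* [Main] is the scan of the input.  A bar name is pushed and emitted as [TBar]
   ([Push]).  For a plain name the input head goes to its symbol ([Fwd]) and
   the stack is searched downwards ([Look]), comparing leftwards with each
   binder ([Cmp]), leaving the binder ([Skip]) and returning to the symbol
   ([Ret], whose flag says that the search is over); a free name is emitted by
   [Copy], and [Up] returns to the top of the stack.  [Pop] and [PopBits] close
   a node; [Final] compares the two output tapes from right to left. *)
Inductive label :=
| Main | Push | Fwd | Look | Cmp | Skip of bool | Ret of bool | Copy | Up
| Pop | PopBits | Final | Halt of bool.

Definition label_code (p : label) : 'I_13 * bool :=
  match p with
  | Main => (inord 0, true) | Push => (inord 1, true) | Fwd => (inord 2, true)
  | Look => (inord 3, true) | Cmp => (inord 4, true) | Skip b => (inord 5, b)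
  | Ret b => (inord 6, b) | Copy => (inord 7, true) | Up => (inord 8, true)
  | Pop => (inord 9, true) | PopBits => (inord 10, true)
  | Final => (inord 11, true) | Halt b => (inord 12, b)
  end.

Definition label_decode (x : 'I_13 * bool) : label :=
  nth Main [:: Main; Push; Fwd; Look; Cmp; Skip x.2; Ret x.2; Copy; Up; Pop;
               PopBits; Final; Halt x.2] x.1.

Lemma label_codeK : cancel label_code label_decode.
Proof. by case=> //= *; rewrite /label_decode /= inordK. Qed.

HB.instance Definition _ := Finite.copy label (can_type label_codeK).

Section Machine.
Variables (S : finType).
Local Notation tok := (token S).

(** [Switch] exchanges the roles of the two output tapes, and [Back] moves both of their heads
    left. *)
Inductive output := Quiet | Emit of tok | Switch | Back.

Definition is_bit (x : option tok) := if x is Some (TBit _) then true else false.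

(* [None] as stack symbol leaves the scanned cell unchanged; [c2] is scanned on
   the active output tape, [c3] on the other one. *)
Definition trans (p : label) (c0 c1 c2 c3 : option tok) :
    label * move * (option (option tok) * move) * output :=
  match p with
  | Main =>
    match c0 with
    | Some TBar => (Push, MoveR, (None, MoveS), Emit TBar)
    | Some (TBit _) | Some (TSym _) => (Fwd, MoveS, (None, MoveS), Quiet)
    | Some TOpen => (Main, MoveR, (None, MoveS), Quiet)
    | Some TClose => (Pop, MoveR, (None, MoveL), Quiet)
    | Some TSep => (Main, MoveR, (None, MoveS), Switch)
    | None => (Final, MoveS, (None, MoveS), Back)
    end
  | Push =>
    match c0 with
    | Some (TSym f) => (Main, MoveR, (Some (Some TBar), MoveR), Emit (TSym f))
    | _ => (Push, MoveR, (Some c0, MoveR), Quiet)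
    end
  | Fwd =>
    match c0 with
    | Some (TSym f) => (Look, MoveS, (None, MoveL), Quiet)
    | _ => (Fwd, MoveR, (None, MoveS), Quiet)
    end
  | Look =>
    match c1 with
    | Some TOpen => (Look, MoveS, (None, MoveL), Emit TClose)
    (* The marker [TBar] lies above the bits of a binder, so both heads step left to where the last
       bits of the two names would be. *)
    | Some _ => (Cmp, MoveL, (None, MoveL), Quiet)
    | None => (Copy, MoveL, (None, MoveS), Emit TSep)
    end
  | Cmp =>
    match is_bit c0, is_bit c1 with
    (* Both numerals are exhausted together, so the names agree. *)
    | false, false => (Skip true, MoveS, (None, MoveS), Emit TOpen)
    | true, true =>
      if c0 == c1 then (Cmp, MoveL, (None, MoveL), Quiet)
      else (Skip false, MoveS, (None, MoveS), Emit TClose)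
    | _, _ => (Skip false, MoveS, (None, MoveS), Emit TClose)
    end
  | Skip b =>
    if is_bit c1 then (Skip b, MoveS, (None, MoveL), Quiet)
    else (Ret b, MoveR, (None, MoveS), Quiet)
  | Ret b =>
    match c0 with
    | Some (TSym f) =>
      if b then (Up, MoveS, (None, MoveR), Quiet)
      else (Look, MoveS, (None, MoveS), Quiet)
    | _ => (Ret b, MoveR, (None, MoveS), Quiet)
    end
  | Copy =>
    match c0 with
    | Some (TBit x) => (Copy, MoveL, (None, MoveS), Emit (TBit x))
    | _ => (Ret true, MoveR, (None, MoveS), Quiet)
    end
  | Up =>
    match c1, c0 with
    | None, Some x => (Main, MoveR, (Some (Some TOpen), MoveR), Emit x)
    | _, _ => (Up, MoveS, (None, MoveR), Quiet)
    end
  | Pop => (PopBits, MoveS, (Some None, MoveL), Quiet)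
  | PopBits =>
    if is_bit c1 then (PopBits, MoveS, (Some None, MoveL), Quiet)
    else (Main, MoveS, (None, MoveR), Quiet)
  | Final =>
    if c2 == c3 then
      if c2 is None then (Halt true, MoveS, (None, MoveS), Quiet)
      else (Final, MoveS, (None, MoveS), Back)
    else (Halt false, MoveS, (None, MoveS), Quiet)
  | Halt b => (p, MoveS, (None, MoveS), Quiet)
  end.

(** The auxiliary alphabet is empty, so the default [TBar] never arises. *)
Definition untok (x : tok + void) : tok := if x is inl y then y else TBar.

Definition out_tape (b : bool) : 'I_4 :=
  if b then Ordinal (isT : 3 < 4) else Ordinal (isT : 2 < 4).

Definition stack_tape : 'I_4 := Ordinal (isT : 1 < 4).

(* The boolean in the state selects the active output tape. *)
Definition alpha_delta (q : bool * label) (s : {ffun 'I_4 -> option (tok + void)}) :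
    (bool * label) * ('I_4 -> option (tok + void) * move) :=
  let: (b, p) := q in
  let c k := omap untok (s k) in
  let: (p', m0, (w, m1), e) :=
    trans p (c ord0) (c stack_tape) (c (out_tape b)) (c (out_tape (~~ b))) in
  ((if e is Switch then ~~ b else b, p'),
   fun k =>
     if k == ord0 then (s k, m0)
     else if k == stack_tape then (if w is Some x then omap inl x else s k, m1)
     else match e with
          | Emit x => if k == out_tape b then (Some (inl x), MoveR) else (s k, MoveS)
          | Back => (s k, MoveL)
          | _ => (s k, MoveS)
          end).

Definition alpha_machine : machine tok :=
  @Machine tok (bool * label)%type void 3 (false, Main)
    (fun q => if q.2 is Halt b then Some b else None) alpha_delta.

(** * Simulation by configurations on zippers *)

Record acfg := ACfg {
  lab : label; inp : zipper tok; stack : zipper tok;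
  out : zipper tok; out' : zipper tok }.

Definition astep (c : acfg) : acfg :=
  let: ACfg p z0 z1 z2 z3 := c in
  let: (p', m0, (w, m1), e) := trans p (read z0) (read z1) (read z2) (read z3) in
  let z0' := go m0 z0 in
  let z1' := go m1 (if w is Some x then put x z1 else z1) in
  match e with
  | Quiet => ACfg p' z0' z1' z2 z3
  | Emit x => ACfg p' z0' z1' (go MoveR (put (Some x) z2)) z3
  | Switch => ACfg p' z0' z1' z3 z2
  | Back => ACfg p' z0' z1' (go MoveL z2) (go MoveL z3)
  end.

Definition sim (c : config alpha_machine) (a : acfg) :=
  exists b, [/\ cstate c = (b, lab a),
    zip_of untok (ctapes c ord0) = inp a,
    zip_of untok (ctapes c stack_tape) = stack a,
    zip_of untok (ctapes c (out_tape b)) = out a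
    & zip_of untok (ctapes c (out_tape (~~ b))) = out' a].

#[local] Arguments shift : simpl never.
#[local] Arguments write : simpl never.
#[local] Arguments zip_of : simpl never.
#[local] Arguments go : simpl never.

(** In a halting state both systems idle, so runs of any length stay in step. *)
Lemma sim_step c a : sim c a -> sim (step c) (astep a).
Proof.
case: c a => q T [p z0 z1 z2 z3] [b [/= -> <- <- <- <-]].
have -> : step (@Config _ alpha_machine (b, p) T) =
    if p is Halt _ then @Config _ alpha_machine (b, p) T else
    let: (q, instr) := alpha_delta (b, p) [ffun k => scanned (T k)] in
    @Config _ alpha_machine q (fun k => shift (instr k).2 (write (instr k).1 (T k))).
  by rewrite /step /=; case: p.
rewrite /= !ffunE -!read_zip.
case E: trans => [[[p' m0] [w m1]] e].
case: (boolP (if p is Halt _ then true else false)) => hp.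
  case: p hp E => // h _ [<- <- <- <- <-]; exists b; split=> //=.
have -> : forall c d : config alpha_machine,
  (if p is Halt _ then c else d) = d by move=> c d; case: p hp {E}.
have uninl x : omap untok (omap inl x) = x by case: x.
exists (if e is Switch then ~~ b else b).
case: e {E} => [|x||]; rewrite ?negbK; case: b; split=> //=;
  rewrite ?ffunE ?zip_shift ?write_scanned ?zip_write //;
  by case: w => [x'|]; rewrite -?zip_write ?write_scanned // zip_write uninl.
Qed.

Definition reach n c d := exists2 m, m <= n & iter m astep c = d.

Lemma reach0 n c : reach n c c.
Proof. by exists 0. Qed.

Lemma reach_step n c d : reach n (astep c) d -> reach n.+1 c d.
Proof. by case=> m mn <-; exists m.+1; rewrite // iterSr. Qed.

Lemma reach_trans n m c d e : reach n c d -> reach m d e -> reach (n + m) c e.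
Proof.
case=> i ni <- [j mj <-]; exists (j + i); first by rewrite addnC leq_add.
by rewrite iterD.
Qed.

Lemma reach_le n m c d : n <= m -> reach n c d -> reach m c d.
Proof. by move=> nm [i /leq_trans/(_ nm) ? ?]; exists i. Qed.

Lemma alpha_machine_run n (w : seq tok) b z0 z1 z2 z3 :
  reach n (ACfg Main (Z [::] w) (Z [::] [::]) (Z [::] [::]) (Z [::] [::]))
    (ACfg (Halt b) z0 z1 z2 z3) ->
  halts_within alpha_machine n w b.
Proof.
case=> m mn E; exists m => //.
suff [b' [-> _ _ _ _]] : sim (iter m (@step _ alpha_machine) (init alpha_machine w))
    (ACfg (Halt b) z0 z1 z2 z3) by [].
rewrite -E; elim: m {mn E} => [|m IH]; last exact: sim_step.
exists false; split=> //=; case: w => [|x w] //=; rewrite /Z; congr (_, _ :: _).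
by elim: w => //= y w ->.
Qed.
End Machine.

(** * Runs of the machine *)

Section Runs.
Variables (S : finType) (ar : S -> nat).
Implicit Types (l r k s o : seq (token S)) (u w : bitseq) (z : zipper (token S)).
#[local] Arguments go : simpl never.
#[local] Arguments put : simpl never.
#[local] Arguments ZL : simpl never.
#[local] Arguments Z : simpl never.

Local Notation tbits u := (map (@TBit S) u).

Lemma goR_Z l x r : go MoveR (Z l (x :: r)) = Z (x :: l) r.
Proof. by []. Qed.

Lemma goL_Z l r : go MoveL (Z l r) = ZL l r.
Proof. by []. Qed.

Lemma ZL_cons x l r : ZL (x :: l) r = Z l (x :: r).
Proof. by []. Qed.

Lemma goS z : go MoveS z = z.
Proof. by []. Qed.

Lemma put_Z l x : put (Some x) (Z l [::]) = Z l [:: x].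
Proof. by []. Qed.

Lemma erase_Z l x : put None (Z l [:: x]) = Z l [::].
Proof. by []. Qed.

Definition zE := (ZL_cons, read_Z, read_ZL, goL_Z, goS, put_Z, erase_Z, goR_Z, @goR_ZL).

Ltac one_step := apply: reach_step; rewrite /astep /= ?zE /= ?zE /=.

Lemma rev_tbits_cons x u l : rev (tbits (x :: u)) ++ l = rev (tbits u) ++ TBit x :: l.
Proof. by rewrite /= rev_cons cat_rcons. Qed.

Lemma push_run u f l r k o z :
  reach (size u).+1
    (ACfg Push (Z l (tbits u ++ TSym f :: r)) (Z k [::]) (Z o [::]) z)
    (ACfg Main (Z (TSym f :: rev (tbits u) ++ l) r)
       (Z (TBar :: rev (tbits u) ++ k) [::]) (Z (TSym f :: o) [::]) z).
Proof.
elim: u l k => [|x u IH] l k; one_step; first exact: reach0.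
by rewrite -/(tbits u) !rev_tbits_cons; apply: IH.
Qed.

Lemma fwd_run u f l r z1 z2 z3 :
  reach (size u) (ACfg Fwd (Z l (tbits u ++ TSym f :: r)) z1 z2 z3)
    (ACfg Fwd (Z (rev (tbits u) ++ l) (TSym f :: r)) z1 z2 z3).
Proof.
elim: u l => [|x u IH] l; first exact: reach0.
by one_step; rewrite rev_tbits_cons; apply: IH.
Qed.

Lemma ret_run b u f l r z1 z2 z3 :
  reach (size u) (ACfg (Ret b) (Z l (tbits u ++ TSym f :: r)) z1 z2 z3)
    (ACfg (Ret b) (Z (rev (tbits u) ++ l) (TSym f :: r)) z1 z2 z3).
Proof.
elim: u l => [|x u IH] l; first exact: reach0.
by one_step; rewrite rev_tbits_cons; apply: IH.
Qed.

Lemma copy_run u l r z1 o z3 : ~~ is_bit (ohead l) ->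
  reach (size u).+1 (ACfg Copy (ZL (tbits u ++ l) r) z1 (Z o [::]) z3)
    (ACfg (Ret true) (Z l (rev (tbits u) ++ r)) z1 (Z (rev (tbits u) ++ o) [::]) z3).
Proof.
move=> hl; elim: u r o => [|x u IH] r o.
  by one_step; case: l hl => [|[]] //= *; rewrite ?zE; apply: reach0.
by one_step; rewrite !rev_tbits_cons; apply: IH.
Qed.

(** The move to the right undoes the last step of the comparison, which left the input head one cell
    before the bits still to be passed. *)
Lemma skip_run b u z0 k s z2 z3 : ~~ is_bit (ohead k) ->
  reach (size u).+1 (ACfg (Skip b) z0 (ZL (tbits u ++ k) s) z2 z3)
    (ACfg (Ret b) (go MoveR z0) (ZL k (rev (tbits u) ++ s)) z2 z3).
Proof.
move=> hk; elim: u s => [|x u IH] s.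
  by one_step; rewrite (negPf hk) !zE; apply: reach0.
by one_step; rewrite !rev_tbits_cons; apply: IH.
Qed.

(* [u1] is the part of [u] scanned before the first mismatch. *)
Lemma cmp_run u w l r k s o z :
  ~~ is_bit (ohead l) -> ~~ is_bit (ohead k) ->
  exists u1 u2, u = u1 ++ u2 /\
  reach (size w).+2
    (ACfg Cmp (ZL (tbits u ++ l) r) (ZL (tbits w ++ k) s) (Z o [::]) z)
    (ACfg (Ret (u == w)) (Z (tbits u2 ++ l) (rev (tbits u1) ++ r))
       (ZL k (rev (tbits w) ++ s))
       (Z ((if u == w then TOpen else TClose) :: o) [::]) z).
Proof.
move=> hl hk; elim: u w r s => [|x u IH] [|y w] r s.
- exists [::], [::]; split=> //; one_step; rewrite (negPf hl) (negPf hk) /= ?zE.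
  by have := @skip_run true [::] (ZL l r) k s; rewrite zE; apply.
- exists [::], [::]; split=> //; one_step; rewrite (negPf hl) /= ?zE.
  have := @skip_run false (y :: w) (ZL l r) k s; rewrite zE /= zE; exact.
- exists [::], (x :: u); split=> //; one_step; rewrite (negPf hk) /= ?zE.
  have := @skip_run false [::] (ZL (tbits (x :: u) ++ l) r) k s; rewrite zE /= ?zE; exact.
have [<-|xy] := eqVneq x y.
  have [u1 [u2 [ue run]]] := IH w (TBit x :: r) (TBit x :: s).
  exists (x :: u1), u2; split; first by rewrite ue.
  one_step; rewrite eqxx !rev_tbits_cons /= ?zE eqseq_cons eqxx /=.
  exact: run.
exists [::], (x :: u); split=> //; one_step.
have -> : (Some (TBit x) == Some (TBit y) :> option (token S)) = false.
  by apply/negbTE; apply: contraNneq xy => -[->].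
rewrite eqseq_cons (negPf xy) /= ?zE.
have := @skip_run false (y :: w) (ZL (tbits (x :: u) ++ l) r) k s; rewrite zE /= ?zE; exact.
Qed.

(* Top of the stack first. *)
Definition frame_word (e : option name) : seq (token S) :=
  if e is Some a then TBar :: tbits (rev (bits a)) else [:: TOpen].

Definition stack_word (E : seq (option name)) := flatten (map frame_word E).

Lemma stack_word_bit E : ~~ is_bit (ohead (stack_word E)).
Proof. by case: E => [|[a|] E]. Qed.

(** [k] and [s'] split the stack where the search stops; only their union matters, because [Up]
    climbs back to the top. Each frame has at least one cell, so its cost fits into one factor per
    cell; the extra factor pays for the bottom. *)
Lemma lookup_run a f l r z : ~~ is_bit (ohead l) -> forall E s o,
  let z0 := Z (tbits (rev (bits a)) ++ l) (TSym f :: r) in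
  exists k s', rev s' ++ k = rev s ++ stack_word E /\
  reach ((size (stack_word E)).+1 * (2 * size (bits a) + 4))
    (ACfg Look z0 (ZL (stack_word E) s) (Z o [::]) z)
    (ACfg Up z0 (Z k s') (Z (rev (name_code S E a) ++ o) [::]) z).
Proof.
move=> hl E s o z0; set A := size (bits a); set u := rev (bits a) in z0 *.
have su : size u = A by rewrite size_rev.
(* A comparison may stop inside the name; the input head then returns to the symbol. *)
have ret b u1 u2 z1 z2 : u = u1 ++ u2 ->
  reach A (ACfg (Ret b) (Z (tbits u2 ++ l) (rev (tbits u1) ++ TSym f :: r)) z1 z2 z)
        (ACfg (Ret b) z0 z1 z2 z).
  move=> ue; have := ret_run b (rev u1) f (tbits u2 ++ l) r z1 z2 z.
  rewrite map_rev revK size_rev catA -map_cat -ue; apply: reach_le.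
  by rewrite -su ue size_cat leq_addr.
elim: E s o => [|[x|] E IH] s o.
(* At the bottom the name is free, and its bits are copied from right to left. *)
- exists [::], s; split=> //; apply: (@reach_le _ (1 + ((size u).+1 + (A + 1)))).
    by rewrite su; lia.
  one_step; apply: reach_trans (copy_run _ _ _ _ _ hl) _.
  apply: reach_trans (ret true u [::] _ _ (esym (cats0 u))) _.
  one_step; rewrite rev_cons revK cat_rcons /u -!map_rev !revK.
  exact: reach0.
- have [u1 [u2 [ue run]]] :=
    cmp_run u (rev (bits x)) (TSym f :: r) (TBar :: s) o z hl (stack_word_bit E).
  set w := rev (bits x) in run.
  have ex : (Some x == Some a) = (u == w).
    by rewrite (inj_eq Some_inj) eq_sym /u (inj_eq (can_inj revK)) (inj_eq bits_inj).
  have sE : size (stack_word (Some x :: E)) = (size w).+1 + size (stack_word E).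
    by rewrite /= size_cat size_map.
  (* The phase common to both outcomes: entering the frame, comparing, returning. *)
  have pre n d :
    reach n
      (ACfg (Ret (u == w)) z0 (ZL (stack_word E) (rev (tbits w) ++ TBar :: s))
        (Z ((if u == w then TOpen else TClose) :: o) [::]) z) d ->
    reach (1 + ((size w).+2 + (A + n)))
      (ACfg Look z0 (ZL (stack_word (Some x :: E)) s) (Z o [::]) z) d.
    move=> H; apply: reach_step; rewrite /astep /= ?zE /= ?zE /= -/w.
    apply: reach_trans run _; apply: reach_trans H; exact: ret.
  rewrite [name_code _ _ _]/= ex; move: pre; case: eqP => _ pre.
    exists (stack_word E), (rev (tbits w) ++ TBar :: s); split.
      by rewrite rev_cat revK rev_cons cat_rcons -catA.
    apply: reach_le (pre 1 _ _); first by rewrite sE; nia.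
    by one_step; apply: reach0.
  have [k [s' [ks run']]] := IH (rev (tbits w) ++ TBar :: s) (TClose :: o).
  exists k, s'; split.
    by rewrite ks rev_cat revK rev_cons cat_rcons -catA.
  apply: reach_le (pre _.+1 _ _); last first.
    by one_step; rewrite rev_cons cat_rcons; exact: run'.
  by rewrite sE; nia.
have [k [s' [ks run]]] := IH (TOpen :: s) (TClose :: o).
exists k, s'; split; first by rewrite ks rev_cons cat_rcons.
apply: (@reach_le _ _.+1); last by one_step; rewrite rev_cons cat_rcons; exact: run.
by have -> : size (stack_word (None :: E)) = (size (stack_word E)).+1 by []; nia.
Qed.

Lemma up_run f l r k s o z :
  reach (size s).+1
    (ACfg Up (Z l (TSym f :: r)) (Z k s) (Z o [::]) z)
    (ACfg Main (Z (TSym f :: l) r) (Z (TOpen :: rev s ++ k) [::])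
       (Z (TSym f :: o) [::]) z).
Proof.
elim: s k => [|x s IH] k; one_step; first exact: reach0.
by rewrite rev_cons cat_rcons; apply: IH.
Qed.

Lemma pop_bits_run u z0 k z2 z3 : ~~ is_bit (ohead k) ->
  reach (size u).+1 (ACfg PopBits z0 (ZL (tbits u ++ k) [::]) z2 z3)
    (ACfg Main z0 (Z k [::]) z2 z3).
Proof.
move=> hk; elim: u => [|x u IH]; one_step; last exact: IH.
by rewrite (negPf hk) ?zE; apply: reach0.
Qed.

(** The words are consumed from the head leftwards, and a blank met on both tapes at once means
    equality. *)
Lemma final_run z0 z1 o1 o2 s1 s2 : exists z2 z3,
  reach (size o1).+1 (ACfg Final z0 z1 (ZL o1 s1) (ZL o2 s2))
    (ACfg (Halt (o1 == o2)) z0 z1 z2 z3).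
Proof.
elim: o1 o2 s1 s2 => [|x o1 IH] [|y o2] s1 s2.
- by do 2!eexists; one_step; apply: reach0.
- by do 2!eexists; one_step; apply: reach0.
- by do 2!eexists; one_step; apply: reach0.
have [xy|xy] := eqVneq x y; last first.
  do 2!eexists; one_step; rewrite (inj_eq Some_inj) eqseq_cons (negPf xy) /= ?zE.
  exact: reach0.
have [z2 [z3 run]] := IH o2 (x :: s1) (y :: s2).
exists z2, z3; one_step; rewrite (inj_eq Some_inj) eqseq_cons xy eqxx /= ?zE -{1}xy.
exact: run.
Qed.

(** * Serialising a whole tree in cubic time *)

Definition node_cost n := n.+1 * (2 * n + 4) + 2 * n + 7.

(** The stack is restored at the end. The size bound is an invariant because the stack grows only at
    the expense of input already read. *)
Definition serialises n E (word code : seq (token S)) :=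
  forall l r o z,
  ~~ is_bit (ohead l) -> size (stack_word E) + size word <= n ->
  reach (size word * node_cost n)
    (ACfg Main (Z l (word ++ r)) (Z (stack_word E) [::]) (Z o [::]) z)
    (ACfg Main (Z (rev word ++ l) r) (Z (stack_word E) [::]) (Z (rev code ++ o) [::]) z).

(** The closing bracket stops the leftward scan of a name that begins the next sibling. *)
Lemma encode_last (t : tree ar) l : ~~ is_bit (ohead (rev (encode t) ++ l)).
Proof. by case: t => alpha f ts /=; rewrite -cat_cons -cat_rcons -cats1 !catA rev_cat. Qed.

Lemma forest_run n E (I : Type) (ts : I -> tree ar) (s : seq I) :
  (forall i, serialises n E (encode (ts i)) (alpha_code E (ts i))) ->
  serialises n E (flatten [seq encode (ts i) | i <- s])
    (flatten [seq alpha_code E (ts i) | i <- s]).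
Proof.
move=> IH; elim: s => [|i s IHs] l r o z hl /=; first by move=> _; exact: reach0.
rewrite size_cat => hn; rewrite mulnDl -!catA; apply: reach_trans.
  by apply: IH => //; lia.
rewrite !rev_cat -!catA; apply: IHs; first exact: encode_last.
by lia.
Qed.

Lemma head_run n alpha f E l r o z :
  ~~ is_bit (ohead l) ->
  size (stack_word E) + size (encode_bname S alpha) <= n ->
  reach (n.+1 * (2 * n + 4) + 2 * n + 3)
    (ACfg Main (Z l (encode_bname S alpha ++ TSym f :: r))
       (Z (stack_word E) [::]) (Z o [::]) z)
    (ACfg Main (Z (TSym f :: rev (encode_bname S alpha) ++ l) r)
       (Z (stack_word (frame alpha :: E)) [::])
       (Z (TSym f :: rev (bname_code S E alpha) ++ o) [::]) z).
Proof.
move=> hl; case: alpha => a /=; rewrite size_map => hn; last first.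
  apply: (@reach_le _ (1 + (size (bits a)).+1)); first by lia.
  one_step; rewrite rev_cons cat_rcons /stack_word /= map_rev; exact: push_run.
apply: (@reach_le _ (1 + (size (bits a) + (1 + ((size (stack_word E)).+1 * (2 * size (bits a) + 4)
  + (size (stack_word E)).+1))))); first by nia.
apply: reach_step.
(* The numeral of 0 is empty, so the scanned token is a bit or already the symbol; both lead to
   [Fwd]. *)
have -> : astep (ACfg Main (Z l (tbits (bits a) ++ TSym f :: r))
      (Z (stack_word E) [::]) (Z o [::]) z) =
    ACfg Fwd (Z l (tbits (bits a) ++ TSym f :: r)) (Z (stack_word E) [::]) (Z o [::]) z.
  by case: (bits a).
apply: reach_trans (fwd_run _ _ _ _ _ _ _) _; one_step; rewrite -map_rev.
have [k [s [ks run]]] := lookup_run a f r z hl E [::] o.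
apply: reach_trans run _; have -> : stack_word (None :: E) = TOpen :: rev s ++ k by rewrite ks.
apply: reach_le (up_run _ _ _ _ _ _ _).
by move: (congr1 size ks); rewrite !size_cat size_rev /=; lia.
Qed.

Lemma pop_run alpha E z0 z2 z3 :
  reach (size (encode_bname S alpha)).+2
    (ACfg Pop z0 (ZL (stack_word (frame alpha :: E)) [::]) z2 z3)
    (ACfg Main z0 (Z (stack_word E) [::]) z2 z3).
Proof.
have hE := stack_word_bit E; case: alpha => a /=.
  apply: (@reach_le _ 2) => //; rewrite /stack_word /=; one_step.
  exact: (pop_bits_run [::] _ _ _ hE).
rewrite size_map -size_rev /stack_word /=; one_step; apply: reach_le (pop_bits_run _ _ _ _ hE).
by lia.
Qed.

Lemma tree_run n E (t : tree ar) : serialises n E (encode t) (alpha_code E t).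
Proof.
elim/tree_ind_ffun: t E => alpha f ts IH E l r o z hl.
have forest := @forest_run n _ _ _ (enum 'I_(ar f)) (fun i => IH i (frame alpha :: E)).
rewrite /=; set body := flatten [seq encode _ | _ <- _] in forest *.
set code := flatten _ in forest *.
have sE : size (stack_word (frame alpha :: E)) <=
    (size (encode_bname S alpha)).+1 + size (stack_word E).
  rewrite /stack_word /= size_cat leq_add2r.
  by case: {forest code} alpha => a //=; rewrite !size_map size_rev.
rewrite size_cat /= size_cat /= => hn.
(* Head, opening bracket, body, closing bracket and popping; all but the body is charged to the
   node's own tokens, of which there are at least three. *)
apply: (@reach_le _ (n.+1 * (2 * n + 4) + 2 * n + 3 +
    (1 + (size body * node_cost n + (1 + n.+2))))).
  by rewrite /node_cost; nia.
rewrite -!catA /=; apply: reach_trans; first by apply: head_run => //; lia.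
one_step; rewrite -catA; apply: reach_trans; first by apply: forest => //; lia.
have -> : rev (encode_bname S alpha ++ [:: TSym f, TOpen & body ++ [:: TClose]]) ++ l =
    TClose :: rev body ++ [:: TOpen, TSym f & rev (encode_bname S alpha) ++ l].
  by rewrite rev_cat 2!rev_cons rev_cat -!cats1 -!catA.
have -> : rev (bname_code S E alpha ++ TSym f :: code) ++ o =
    rev code ++ TSym f :: rev (bname_code S E alpha) ++ o.
  by rewrite rev_cat rev_cons -cats1 -!catA.
rewrite cat1s; one_step.
by apply: reach_le (pop_run _ _ _ _ _); lia.
Qed.

Lemma size_name_code E a : size (name_code S E a) <= size (stack_word E) + (size (bits a)).+1.
Proof.
elim: E => [|e E IH] /=; first by rewrite size_rev size_map.
have -> : size (stack_word (e :: E)) = size (frame_word e) + size (stack_word E) by exact: size_cat.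
by case: eqP => _ /=; case: e => [x|] /=; lia.
Qed.

(** Bounds the time of the final comparison; the generous estimate by [node_cost] keeps the total
    cubic. *)
Lemma size_alpha_code n E (t : tree ar) :
  size (stack_word E) + size (encode t) <= n ->
  size (alpha_code E t) <= size (encode t) * node_cost n.
Proof.
elim/tree_ind_ffun: t E => alpha f ts IH E /=.
rewrite !size_cat /= size_cat /=; set body := flatten [seq encode _ | _ <- _] => hn.
have sE : size (stack_word (frame alpha :: E)) <=
    (size (encode_bname S alpha)).+1 + size (stack_word E).
  rewrite /stack_word /= size_cat leq_add2r.
  by case: alpha {IH hn} => a //=; rewrite !size_map size_rev.
have hb : size (bname_code S E alpha) <= n.+1.
  case: alpha {sE IH} hn => a //=; rewrite size_map => hn.
  by apply: leq_trans (size_name_code E a) _; lia.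
suff : size (flatten [seq alpha_code (frame alpha :: E) (ts i) | i <- enum 'I_(ar f)])
    <= size body * node_cost n.
  have : n.+2 <= node_cost n by rewrite /node_cost; nia.
  move: (size (flatten _)) (size body) (size (encode_bname S alpha))
    (size (bname_code S E alpha)) (node_cost n) hb.
  by move=> c b A B K; clear; nia.
have : size (stack_word (frame alpha :: E)) + size body <= n by lia.
rewrite /body => {hn hb sE body}; elim: (enum _) => //= i s IHs.
rewrite (size_cat (alpha_code _ _)) (size_cat (encode _)) mulnDl => hs.
by apply: leq_add; [apply: IH | apply: IHs]; lia.
Qed.

End Runs.

Theorem corollary4p9 (S : finType) (ar : S -> nat) :
  ptime_decidable (@encode_pair S ar) (fun st => alpha_eq st.1 st.2).
Proof.
(* Coefficients, lowest first, of [2 * n * node_cost n + 3]. *)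
exists (alpha_machine S), (Poly [:: 3; 22; 16; 4]) => -[s t].
(* After the switch at [TSep] the active tape holds the code of [t]; left half-tapes list it in
   reverse. *)
exists (rev (alpha_code [::] t) == rev (alpha_code [::] s)); last first.
  rewrite (inj_eq (can_inj revK)) eq_sym -alpha_codeP.
  by split=> [/eqP|->].
set n := size (encode_pair (s, t)).
have en : n = size (encode s) + (size (encode t)).+1 by rewrite /n size_cat.
have [z2 [z3 fin]] := final_run (Z (rev (encode t) ++ TSep :: rev (encode s)) [::])
  (Z [::] [::]) (rev (alpha_code [::] t)) (rev (alpha_code [::] s)) [::] [::].
have code_size : size (alpha_code [::] t) <= size (encode t) * node_cost n.
  by apply: size_alpha_code; rewrite /=; lia.
(* The second summand for [t] pays for the comparison of the outputs. *)
have : reach (size (encode s) * node_cost n + (1 + (size (encode t) * node_cost n + (1 +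
    (size (encode t) * node_cost n).+1))))
  (ACfg Main (Z [::] (encode_pair (s, t))) (Z [::] [::]) (Z [::] [::]) (Z [::] [::]))
  (ACfg (Halt (rev (alpha_code [::] t) == rev (alpha_code [::] s)))
    (Z (rev (encode t) ++ TSep :: rev (encode s)) [::]) (Z [::] [::]) z2 z3).
  rewrite /encode_pair /=.
  have run1 := @tree_run _ _ n [::] s [::] (TSep :: encode t) [::] (Z [::] [::]) isT.
  apply: reach_trans; first by apply: run1; rewrite /=; lia.
  apply: reach_step; rewrite /astep /= ?zE !cats0 /=.
  have run2 := @tree_run _ _ n [::] t (TSep :: rev (encode s)) [::] [::].
  rewrite cats0 in run2.
  apply: reach_trans; first by apply: run2; rewrite /=; lia.
  apply: reach_step; rewrite /astep /= ?zE !cats0 /=.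
  by apply: reach_le fin; rewrite size_rev.
move/alpha_machine_run; case=> m mn run; exists m => //; apply: leq_trans mn _.
rewrite horner_Poly /= -/n.
(* By conversion, the ring operations on [nat] become the usual ones, as [lia] expects. *)
rewrite -[X in _ <= X]/((((0 * n + 4) * n + 16) * n + 22) * n + 3)%N.
have : (size (encode s) + size (encode t) + size (encode t)) * node_cost n <=
    2 * n * node_cost n by rewrite leq_mul2r; lia.
by rewrite !mulnDl /node_cost; lia.
Qed.
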